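(* Let $\mathbf{D}$ be a category with finite coproducts and a choice of trivial isomorphisms, with associated congruence $\sim$. Then the quotient category $\mathbf{D}/\!\sim$ has finite phased coproducts. Moreover, the quotient functor $[-]_{\mathbb{T}} \colon \mathbf{D} \to \mathbf{D}/\!\sim$ sends coproducts in $\mathbf{D}$ to phased coproducts in $\mathbf{D}/\!\sim$.
   Context: **Trivial isomorphisms.** A choice of trivial isomorphisms on a category $\mathbf{D}$ is a choice, for each object $A$, of a subgroup $\mathbb{T}_A \subseteq \mathrm{Aut}(A)$ such that for all $f \colon A \to B$ and $q \in \mathbb{T}_B$ there is $p \in \mathbb{T}_A$ with $f \circ p = q \circ f$. Its congruence on morphisms $f,g \colon A \to B$ is: $f \sim g$ iff $f = g \circ p$ for some $p \in \mathbb{T}_A$. The category $\mathbf{D}/\!\sim$ has the same objects as $\mathbf{D}$ and as morphisms the equivalence classes $[f]_{\mathbb{T}}$ of morphisms under $\sim$; $[-]_{\mathbb{T}}$ is the identity-on-objects functor taking equivalence classes. **Phased coproducts.** A phased coproduct of a family $(A_i)_{i \in J}$ of objects is an object $A$ with morphisms $\kappa_i \colon A_i \to A$ (coprojections) such that: (i) for every family $f_i \colon A_i \to B$ there is $f \colon A \to B$ with $f \circ \kappa_i = f_i$ for all $i$; (ii) any $f, f' \colon A \to B$ with $f \circ \kappa_i = f' \circ \kappa_i$ for all $i$ satisfy $f' = f \circ U$ for some endomorphism $U$ of $A$ with $U \circ \kappa_i = \kappa_i$ for all $i$. A category has finite phased coproducts if every finite (possibly empty) family of objects has a phased coproduct.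 *)

(* Defs.v *)
From mathcomp Require Import all_boot.
From mathcomp Require Import boolp classical_sets.

Set Implicit Arguments.
Unset Strict Implicit.
Unset Printing Implicit Defensive.

Local Open Scope classical_set_scope.

Declare Scope cat_scope.
Delimit Scope cat_scope with cat.
Local Open Scope cat_scope.

Record category := Category {
  obj :> Type;
  hom : obj -> obj -> Type;
  idm : forall A, hom A A;
  compm : forall A B C, hom B C -> hom A B -> hom A C;
  compmA : forall A B C E (h : hom C E) (g : hom B C) (f : hom A B),
    compm h (compm g f) = compm (compm h g) f;
  comp1m : forall A B (f : hom A B), compm (idm B) f = f;
  compm1 : forall A B (f : hom A B), compm f (idm A) = f
}.

Arguments hom {_} _ _.
Arguments idm {_} A.
Arguments compm {_ A B C} g f.

Notation "g ∘ f" := (compm g f) (at level 40, left associativity) : cat_scope.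

Record functor (C D : category) := Functor {
  fobj :> C -> D;
  fmap : forall A B : C, hom A B -> hom (fobj A) (fobj B);
  fmap1 : forall A : C, fmap (idm A) = idm (fobj A);
  fmapM : forall (A B E : C) (g : hom B E) (f : hom A B),
    fmap (g ∘ f) = fmap g ∘ fmap f
}.

Definition inverse_of (C : category) (A B : C) (f : hom A B) (g : hom B A) :=
  g ∘ f = idm A /\ f ∘ g = idm B.

Definition is_iso (C : category) (A B : C) (f : hom A B) :=
  exists g : hom B A, inverse_of f g.

Section Coproducts.
Variables (C : category) (J : Type) (X : J -> C).

Definition is_coproduct (A : C) (kappa : forall i, hom (X i) A) : Prop :=
  forall (B : C) (f : forall i, hom (X i) B),
    exists! h : hom A B, forall i, h ∘ kappa i = f i.

Definition is_phased_coproduct (A : C) (kappa : forall i, hom (X i) A) : Prop :=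
  (forall (B : C) (f : forall i, hom (X i) B),
     exists h : hom A B, forall i, h ∘ kappa i = f i) /\
  (forall (B : C) (f f' : hom A B),
     (forall i, f ∘ kappa i = f' ∘ kappa i) ->
     exists U : hom A A, (forall i, U ∘ kappa i = kappa i) /\ f' = f ∘ U).

End Coproducts.

Definition has_finite_coproducts (C : category) : Prop :=
  forall (J : finType) (X : J -> C),
    exists (A : C) (kappa : forall i, hom (X i) A), is_coproduct kappa.

Definition has_finite_phased_coproducts (C : category) : Prop :=
  forall (J : finType) (X : J -> C),
    exists (A : C) (kappa : forall i, hom (X i) A), is_phased_coproduct kappa.

(* The index type is arbitrary: every coproduct that exists in the domain,
   finite or not, is concerned. *)
Definition sends_coproducts_to_phased (C D : category) (F : functor C D) : Prop :=
  forall (J : Type) (X : J -> C) (A : C) (kappa : forall i, hom (X i) A),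
    is_coproduct kappa -> is_phased_coproduct (fun i => fmap F (kappa i)).

(* A subgroup of Aut(A) is given by its underlying set of endomorphisms. *)
Record trivial_isos (D : category) := TrivialIsos {
  triv :> forall A : D, set (hom A A);
  triv_iso : forall A (p : hom A A), triv p -> is_iso p;
  triv1 : forall A, triv (idm A);
  trivM : forall A (p q : hom A A), triv p -> triv q -> triv (p ∘ q);
  trivV : forall A (p q : hom A A), triv p -> inverse_of p q -> triv q;
  triv_swap : forall A B (f : hom A B) (q : hom B B), triv q ->
    exists2 p : hom A A, triv p & f ∘ p = q ∘ f
}.

Section Quotient.
Variables (D : category) (T : trivial_isos D).

Definition triv_equiv (A B : D) (f g : hom A B) : Prop :=
  exists2 p : hom A A, T A p & f = g ∘ p.

Lemma triv_equiv_refl A B (f : hom A B) : triv_equiv f f.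
Proof. by exists (idm A); [exact: triv1 | rewrite compm1]. Qed.

Lemma triv_equiv_sym A B (f g : hom A B) : triv_equiv f g -> triv_equiv g f.
Proof.
move=> [p Tp ->]; have [q [qp pq]] := triv_iso Tp.
exists q; first by apply: (trivV Tp); split.
by rewrite -compmA pq compm1.
Qed.

Lemma triv_equiv_trans A B (f g h : hom A B) :
  triv_equiv f g -> triv_equiv g h -> triv_equiv f h.
Proof.
move=> [p Tp ->] [q Tq ->]; exists (q ∘ p); first exact: trivM.
by rewrite compmA.
Qed.

Lemma triv_equiv_comp A B C (g g' : hom B C) (f f' : hom A B) :
  triv_equiv g g' -> triv_equiv f f' -> triv_equiv (g ∘ f) (g' ∘ f').
Proof.
move=> [q Tq ->] [p Tp ->]; have [r Tr qf] := triv_swap f' Tq.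
exists (r ∘ p); first exact: trivM.
by rewrite !compmA -[g' ∘ f' ∘ r]compmA qf !compmA.
Qed.

Definition class_of (A B : D) (f : hom A B) : set (hom A B) :=
  [set g | triv_equiv g f].

Definition qhom (A B : D) : Type :=
  {c : set (hom A B) | exists f, c = class_of f}.

Definition qclass (A B : D) (f : hom A B) : qhom A B :=
  exist _ (class_of f) (ex_intro _ f erefl).

Lemma qclassP A B (f g : hom A B) : qclass f = qclass g <-> triv_equiv f g.
Proof.
split=> [[fg] | fg].
  by have : class_of f f by [exact: triv_equiv_refl]; rewrite fg.
apply: eq_exist; apply/seteqP; split=> h hf.
  exact: triv_equiv_trans hf fg.
exact: triv_equiv_trans hf (triv_equiv_sym fg).
Qed.

Lemma qclass_surj A B (c : qhom A B) : exists f, c = qclass f.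
Proof. by case: c => c [f cf]; exists f; apply: eq_exist. Qed.

(* The set of composites of representatives is already a full class. *)
Definition comp_set (A B C : D) (d : set (hom B C)) (c : set (hom A B)) :
  set (hom A C) := [set h | exists g f, [/\ d g, c f & h = g ∘ f]].

Lemma comp_set_class A B C (g : hom B C) (f : hom A B) :
  comp_set (class_of g) (class_of f) = class_of (g ∘ f).
Proof.
apply/seteqP; split=> [h [g' [f' [gg' ff' ->]]] | h [p Tp ->]].
  exact: triv_equiv_comp.
exists g, (f ∘ p); split; [exact: triv_equiv_refl | by exists p |].
by rewrite compmA.
Qed.

Lemma comp_set_subproof A B C (d : qhom B C) (c : qhom A B) :
  exists f, comp_set (sval d) (sval c) = class_of f.
Proof.
have [g ->] := qclass_surj d; have [f ->] := qclass_surj c.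
by exists (g ∘ f); exact: comp_set_class.
Qed.

Definition qcomp (A B C : D) (d : qhom B C) (c : qhom A B) : qhom A C :=
  exist _ (comp_set (sval d) (sval c)) (comp_set_subproof d c).

Lemma qcompE A B C (g : hom B C) (f : hom A B) :
  qcomp (qclass g) (qclass f) = qclass (g ∘ f).
Proof. by apply: eq_exist; exact: comp_set_class. Qed.

Lemma qcompA A B C E (h : qhom C E) (g : qhom B C) (f : qhom A B) :
  qcomp h (qcomp g f) = qcomp (qcomp h g) f.
Proof.
have [h' ->] := qclass_surj h; have [g' ->] := qclass_surj g.
by have [f' ->] := qclass_surj f; rewrite !qcompE compmA.
Qed.

Lemma qcomp1m A B (f : qhom A B) : qcomp (qclass (idm B)) f = f.
Proof. by have [f' ->] := qclass_surj f; rewrite qcompE comp1m. Qed.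

Lemma qcompm1 A B (f : qhom A B) : qcomp f (qclass (idm A)) = f.
Proof. by have [f' ->] := qclass_surj f; rewrite qcompE compm1. Qed.

Definition quotient_category : category :=
  @Category D qhom (fun A => qclass (idm A)) qcomp qcompA qcomp1m qcompm1.

Definition quotient_functor : functor D quotient_category :=
  @Functor D quotient_category (fun A => A) qclass
    (fun=> erefl) (fun A B C g f => esym (qcompE g f)).

End Quotient.

(* Main.v *)
Require Import Defs.
From mathcomp Require Import all_boot.
From mathcomp Require Import boolp.

Set Implicit Arguments.
Unset Strict Implicit.
Unset Printing Implicit Defensive.

Local Open Scope cat_scope.

(** If [f ∘ κ_i ∼ f' ∘ κ_i] for all [i], then [f' ∘ κ_i = f ∘ κ_i ∘ p_i] for
    trivial isomorphisms [p_i]. The cotuple [U] of the morphisms [κ_i ∘ p_i]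
    then satisfies [f' = f ∘ U], and [[U]] fixes each [[κ_i]]. *)

Lemma coproduct_hom_ext (C : category) (J : Type) (X : J -> C) (A : C)
    (kappa : forall i, hom (X i) A) (B : C) (f g : hom A B) :
  is_coproduct kappa -> (forall i, f ∘ kappa i = g ∘ kappa i) -> f = g.
Proof.
move=> copA fg; have [h [_ hU]] := copA B (fun i => g ∘ kappa i).
by rewrite -(hU f fg); apply: hU.
Qed.

Lemma quotient_functor_phased (D : category) (T : trivial_isos D) :
  sends_coproducts_to_phased (quotient_functor T).
Proof.
move=> J X A kappa copA; split=> [B f | B f f' ff'].
  (* [cid] chooses a representative of each class [f i]. Another choice can give an inequivalent
     cotuple, so only existence of the mediating morphism passes to the quotient. *)
  pose r i := cid (qclass_surj (f i)).
  have [h [hr _]] := copA B (fun i => sval (r i)).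
  exists (qclass T h) => i /=.
  by rewrite qcompE hr; exact: esym (svalP (r i)).
have [g fE] := qclass_surj f; have [g' f'E] := qclass_surj f'.
have gg' i : exists p : hom (X i) (X i),
    T (X i) p /\ g' ∘ kappa i = g ∘ kappa i ∘ p.
  (* The equality is reversed before [qclassP] so that the trivial isomorphism falls on the side of
     [g]. *)
  have := ff' i; rewrite fE f'E /= !qcompE => /esym/qclassP [p Tp e].
  by exists p.
pose p i := cid (gg' i).
have [U [UE _]] := copA A (fun i => kappa i ∘ sval (p i)).
exists (qclass T U); split=> [i /= |].
  rewrite qcompE; apply/qclassP; rewrite UE.
  by exists (sval (p i)) => //; case: (svalP (p i)).
rewrite fE f'E /= qcompE; congr qclass.
(* [g' = g ∘ U] holds already in [D], not merely up to equivalence: both sides agree on each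
   [kappa i]. *)
apply: (coproduct_hom_ext copA) => i.
by rewrite -compmA UE compmA; case: (svalP (p i)).
Qed.

Theorem lemma3p2 (D : category) (T : trivial_isos D)
    (hD : has_finite_coproducts D) :
  has_finite_phased_coproducts (quotient_category T) /\
  sends_coproducts_to_phased (quotient_functor T).
Proof.
split; last exact: quotient_functor_phased.
(* The quotient has the objects of [D], so [X] is also a family in [D]. *)
move=> J X; have [A [kappa copA]] := hD J X.
exists A, (fun i => qclass T (kappa i)).
exact: (quotient_functor_phased T copA).
Qed.
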